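(* The following hold: (i) $\gamma'(2)=\gamma(2)=1/4$; (ii) $\gamma'(3)=\gamma(3)=3/8$; (iii) for every integer $\ell\ge 4$, $$\gamma'(\ell)\le\gamma(\ell)\le\frac12-\frac{1}{3\cdot 2^{\ell-1}-4\ell+8}.$$
   Context: Definition of $\gamma(\ell)$, $\ell\in\mathbb N$. Let $M,N\in\mathbb N$ with $N\ge 2M$, let $\lambda:E(K_N)\to\{1,\ldots,\ell\}$ be a labeling of the edges of the complete graph $K_N$, and let $\mathcal M$ be a matching in $K_N$ with $M$ edges. An edge $uv$ of $K_N$ is critical if there is an edge $e\in\mathcal M$ covering $u$ or $v$ (i.e. incident to $u$ or to $v$) with $\lambda(uv)<\lambda(e)$. Let $\gamma(\ell,M,N,\lambda,\mathcal M)$ be the number of critical edges divided by $\binom{2M}{2}$. Then $$\gamma(\ell)=\limsup_{M\to\infty}\ \max_{N\ge 2M}\ \max_{\lambda}\ \min_{\mathcal M}\ \gamma(\ell,M,N,\lambda,\mathcal M),$$ where $\lambda$ ranges over all such labelings and $\mathcal M$ over all matchings of size $M$ in $K_N$. Definition of $\gamma'(\ell)$. This is the special case of perfect matchings, $N=2M$: for a labeling $\lambda:E(K_N)\to\{1,\ldots,\ell\}$ and a perfect matching $\mathcal M$ of $K_N$, an edge $uv$ is critical if $\lambda(uv)$ is strictly less than the maximum of the labels of the two edges of $\mathcal M$ covering $u$ and $v$. Let $\gamma'(\ell,N,\lambda,\mathcal M)$ be the number of critical edges divided by $\binom N2$. Then $$\gamma'(\ell)=\limsup_{N\to\infty,\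 N\text{ even}}\ \max_{\lambda}\ \min_{\mathcal M}\ \gamma'(\ell,N,\lambda,\mathcal M),$$ where $\mathcal M$ ranges over all perfect matchings of $K_N$. *)

(* Defs.v *)
From HB Require Import structures.
From mathcomp Require Import all_boot all_order all_algebra.
From mathcomp Require Import all_classical all_reals all_analysis.
Set Implicit Arguments.
Unset Strict Implicit.
Unset Printing Implicit Defensive.
Import Order.TTheory GRing.Theory Num.Theory.
Local Open Scope classical_set_scope.
Local Open Scope ring_scope.

Definition edge (N : nat) := {e : {set 'I_N} | (#|e| == 2)%N}.

(* The label set {1, ..., l} is represented by 'I_l, with k standing for k + 1;
   only the order of the labels matters. *)
Definition labeling (l N : nat) := {ffun edge N -> 'I_l}.

Definition meets (N : nat) (e f : edge N) : bool :=
  [exists v : 'I_N, (v \in val e) && (v \in val f)].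

Definition is_matching (N : nat) (m : {set edge N}) : bool :=
  [forall e in m, forall f in m, (e != f) ==> ~~ meets e f].

Definition is_perfect_matching (N : nat) (m : {set edge N}) : bool :=
  is_matching m && [forall v : 'I_N, exists e in m, v \in val e].

Definition critical (l N : nat) (lam : labeling l N) (m : {set edge N})
    (e : edge N) : bool :=
  [exists f in m, meets e f && (lam e < lam f)%N].

(* The edges of m meeting e = uv are those covering u or v; when m is a perfect
   matching there are two of them, or just e itself if e \in m. *)
Definition critical_perfect (l N : nat) (lam : labeling l N)
    (m : {set edge N}) (e : edge N) : bool :=
  (lam e < \max_(f in m | meets e f) (lam f : nat))%N.

Definition critical_ratio (R : realType) (l M N : nat) (lam : labeling l N)
    (m : {set edge N}) : \bar R :=
  (#|[pred e | critical lam m e]|%:R / 'C(2 * M, 2)%N%:R)%:E.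

Definition critical_perfect_ratio (R : realType) (l N : nat)
    (lam : labeling l N) (m : {set edge N}) : \bar R :=
  (#|[pred e | critical_perfect lam m e]|%:R / 'C(N, 2)%:R)%:E.

Definition gamma_maxmin (R : realType) (l M N : nat) : \bar R :=
  \big[Order.max/-oo%E]_(lam : labeling l N)
    \big[Order.min/+oo%E]_(m : {set edge N} | is_matching m && (#|m| == M))
      critical_ratio R M lam m.

(* The maximum over the infinite range N >= 2M is a supremum in \bar R; as the
   values share the denominator 'C(2 * M, 2), it is attained once finite. *)
Definition gamma (R : realType) (l : nat) : \bar R :=
  limn_esup (fun M : nat =>
    ereal_sup [set gamma_maxmin R l M N | N in [set N | (2 * M <= N)%N]]).

Definition gamma'_maxmin (R : realType) (l N : nat) : \bar R :=
  \big[Order.max/-oo%E]_(lam : labeling l N)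
    \big[Order.min/+oo%E]_(m : {set edge N} | is_perfect_matching m)
      critical_perfect_ratio R lam m.

(* The limit superior along even N is indexed by N = 2n. *)
Definition gamma' (R : realType) (l : nat) : \bar R :=
  limn_esup (fun n : nat => gamma'_maxmin R l (2 * n)%N).

(* Main.v *)
Require Import Defs.
From HB Require Import structures.
From mathcomp Require Import all_boot all_order all_algebra.
From mathcomp Require Import all_classical all_reals all_analysis.
From mathcomp Require Import fintype finset zify ring lra.
Import Order.TTheory GRing.Theory Num.Theory.
Set Implicit Arguments.
Unset Strict Implicit.
Unset Printing Implicit Defensive.

(** Upper bounds.  Let a label j cost c(j), where c grows a little faster than
    doubling from one label to the next, and take a matching of M edges of
    least total cost.  Three exchanges show that it has few critical edges.
    - Replacing one end of a matching edge: no critical edge leaves the set of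
      matched vertices ([undercut_outside]).
    - Re-pairing the four ends of two matching edges: because 2 c(j-1) <
      c(0) + c(j), of two disjoint edges between the same two matching edges at
      most one is critical, hence at most two of the four are
      ([undercut_pair]).
    - Shifting along an alternating path: if m + 1 matching edges of label k
      are linked in a row by m edges of smaller labels, then re-pairing them
      along the path, and the two loose ends with each other, costs at most
      m c(k-1) + c(l-1).  For m = m_k this is less than (m_k + 1) c(k), so no
      such path exists ([undercut_altpath]).
    The last two facts feed a Turan-type estimate ([alternating_path_bound]):
    n matching edges of label k span at most n^2 (1 - 1 / m_k) edges of smaller
    labels.  Its proof removes a longest alternating path, say through m <= m_k
    matching edges; any other matching edge sends at most 2 (m - 1) such edges
    to it.  If n_k matching edges have label k, summing over all pairs of
    matching edges leaves at most M^2 - sum_k n_k^2 / m_k critical edges, which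
    is at most M^2 (1 - 1 / E) with E = sum_k m_k by Cauchy-Schwarz.  Dividing by binomial(2M, 2), which is
    asymptotic to 2 M^2, gives gamma(l) <= (1 - 1 / E) / 2.  The doubling costs
    make E = 2 for l = 2 and 2 E = 3 * 2^(l-1) - 4 l + 8 for l >= 3.

    Lower bounds.  For l = 3, split K_(8k) into S, T and U with k, 2k and 5k
    vertices; the least label goes to the edges that meet S or lie inside T,
    the middle one to those between T and U, the largest one to those inside U.
    A perfect matching sends at most k vertices of U to S and some t1 vertices
    of T to U; whatever t1 is, at least 12 k^2 - k edges are critical
    ([hub_clique_count]).  For l = 2 the same works without T, with k and 3k
    vertices in S and U.

    Finally gamma'(l) <= gamma(l), because for N = 2M the matchings of size M
    are the perfect ones. *)

(** * Alternating paths *)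

(** A matching with edges indexed by X is handled through its ends: the pair
    (x, b) is one of the two ends of the edge x. *)
Definition opp_end (X : Type) (p : X * bool) : X * bool := (p.1, ~~ p.2).

(** A path that alternates between matching edges and edges of L, recorded by
    the ends through which it enters the successive matching edges; it leaves
    each of them through the opposite end. *)
Definition altpath (X : eqType) (L : rel (X * bool)) (s : seq (X * bool)) :=
  sorted (fun p q => L (opp_end p) q) s && uniq (map fst s).

Definition links (X : Type) (L : rel (X * bool)) (x y : X) : nat :=
  \sum_(b : bool) \sum_(c : bool) L (x, b) (y, c).

Section AlternatingPaths.
Variables (X : finType) (L : rel (X * bool)).
Hypothesis Lsym : symmetric L.
Local Notation step := (fun p q => L (opp_end p) q).

Definition end_links (x : X) (r : X * bool) : nat := L (x, false) r + L (x, true) r.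

Lemma linksE x r : links L x r.1 = end_links x r + end_links x (opp_end r).
Proof.
by rewrite /links /end_links !big_bool; case: r => y [] /=; rewrite /opp_end /=; lia.
Qed.

Lemma linksC x y : links L x y = links L y x.
Proof.
by rewrite /links exchange_big; do 2!apply: eq_bigr => ? _; rewrite Lsym.
Qed.

(** An outside edge x could be inserted between an exit and the next entrance
    in either direction, so if both insertions fail then x has at most two
    links to these two ends; the final exit has none.  The entrance of p is
    left out, so that the statement passes to tails of the path. *)
Lemma end_links_insert x p s :
  path step p s ->
  (forall s1 s2 b, s = s1 ++ s2 -> ~~ path step p (s1 ++ (x, b) :: s2)) ->
  end_links x (opp_end p) + \sum_(r <- s) links L x r.1 <= 2 * size s.
Proof.
elim: s p => [|r s IHs] p /=.
  move=> _ ins; rewrite big_nil addn0 /end_links !(Lsym _ (opp_end p)).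
  move: (ins [::] [::] false erefl) (ins [::] [::] true erefl) => /=.
  by rewrite !andbT => /negbTE-> /negbTE->.
case/andP=> pr rs ins; rewrite big_cons linksE.
have := IHs r rs; move=> /(_ _)/wrap[]; last move=> IH.
  move=> s1 s2 b es; have := ins (r :: s1) s2 b; rewrite es => /(_ erefl) /=.
  by rewrite pr.
have gap b : L (opp_end p) (x, b) + L (x, ~~ b) r <= 1.
  have := ins [::] (r :: s) b erefl; rewrite /= rs andbT /opp_end /=.
  by do 2!case: (L _ _).
have := gap false; have := gap true; rewrite /= /end_links !(Lsym _ (opp_end p)).
by move: IH; rewrite /end_links; lia.
Qed.

(** Every gap of the path receives two links at most, and the two loose ends
    receive none. *)
Lemma links_longest x s :
  altpath L s -> x \notin map fst s ->
  (forall t, altpath L t -> {subset map fst t <= x :: map fst s} ->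
     size t != (size s).+1) ->
  \sum_(r <- s) links L x r.1 <= 2 * (size s).-1.
Proof.
case: s => [|p s]; first by rewrite big_nil.
case/andP=> /= ps us xs long.
have ins s1 s2 b : p :: s = s1 ++ s2 -> ~~ sorted step (s1 ++ (x, b) :: s2).
  move=> es; apply/negP => srt.
  have pe : perm_eq (s1 ++ (x, b) :: s2) ((x, b) :: p :: s).
    by rewrite es -cat1s perm_catCA.
  have /eqP := perm_size pe; apply/negP/long; last first.
    by move=> y; rewrite (perm_mem (perm_map fst pe)).
  rewrite /altpath srt (perm_uniq (perm_map fst pe)) /=.
  by rewrite -[_ && _]/(uniq (x :: map fst (p :: s))) /= xs us.
have tail : end_links x (opp_end p) + \sum_(r <- s) links L x r.1 <= 2 * size s.
  apply: end_links_insert => // s1 s2 b es.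
  by apply: (ins (p :: s1) s2 b); rewrite es.
have head0 : end_links x p = 0.
  have head b : L (x, ~~ b) p = false.
    by have := ins [::] (p :: s) b erefl; rewrite /= ps andbT => /negbTE.
  by rewrite /end_links (head true) (head false).
by rewrite big_cons linksE head0.
Qed.

(** The sum over ordered pairs is twice the number of links, whence the factor
    2.  With P a path through n edges and a = |A| - n, the three parts
    contribute at most 2 (n - 1) a^2 / n, 2 * 2 (n - 1) a and 2 n (n - 1),
    which add up to exactly 2 (n - 1) (a + n)^2 / n.  If no path goes through n
    edges, the stronger bound for n - 1 holds. *)
Lemma alternating_path_bound (n : nat) (A : {set X}) :
  (forall x y, x \in A -> y \in A -> x != y -> links L x y <= 2) ->
  (forall s, altpath L s -> {subset map fst s <= A} -> size s != n.+1) ->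
  n * (\sum_(x in A) \sum_(y in A | y != x) links L x y) <= 2 * n.-1 * #|A| ^ 2.
Proof.
elim: n A => // n IHn A; have [k] := ubnP #|A|.
elim: k A => // k IHk A /ltnSE leAk pair2 noS.
pose P s := altpath L s && all (mem A) (map fst s) && (size s == n.+1).
have [[s]|nos] := pselect (exists s, P s); last first.
  have no s : altpath L s -> {subset map fst s <= A} -> size s != n.+1.
    move=> als sA; apply/negP=> ss; apply: nos; exists s.
    by rewrite /P als ss andbT; apply/allP.
  have := IHn A pair2 no.
  case: n {IHn IHk noS P nos} no => [|n] no IH /=.
    rewrite mul1n muln0 mul0n leqn0 big1 // => x xA.
    have xA' : {subset map fst [:: (x, true)] <= A} by move=> y; rewrite inE => /eqP->.
    by have := no [:: (x, true)] isT xA'.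
  move: IH; set S := \sum_(x in A) _; rewrite /= => IH.
  rewrite -(leq_pmul2l (ltn0Sn n)).
  by apply: leq_trans (_ : n.+2 * (2 * n * #|A| ^ 2) <= _); nia.
move=> /andP[/andP[als /allP sA] /eqP ss]; have us : uniq (map fst s) by case/andP: als.
pose B := [set x in map fst s]; have BA : B \subset A.
  by apply/subsetP=> x; rewrite inE => /sA.
have cB : #|B| = n.+1 by rewrite cardsE (card_uniqP us) size_map ss.
have cA : #|A| = #|A :\: B| + n.+1.
  by rewrite -cB addnC -(cardsID B A) (setIidPr BA).
have IH : n.+1 * (\sum_(x in A :\: B) \sum_(y in A :\: B | y != x) links L x y)
   <= 2 * n * #|A :\: B| ^ 2.
  apply: IHk; first by rewrite cA in leAk; lia.
    by move=> x y /setDP[xA _] /setDP[yA _]; apply: pair2.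
  by move=> t alt tA; apply: noS => // x /tA /setDP[].
have cross x : x \in A :\: B -> \sum_(y in B) links L x y <= 2 * n.
  case/setDP=> xA xB.
  have -> : \sum_(y in B) links L x y = \sum_(r <- s) links L x r.1.
    rewrite -(big_map fst xpredT (links L x)) big_uniq //.
    by apply: eq_bigl => y; rewrite inE.
  have := @links_longest x s als; rewrite ss /=; apply; first by move: xB; rewrite inE.
  move=> t alt tA; apply: noS => // y /tA; rewrite inE => /predU1P[->//|].
  exact: sA.
have inner : \sum_(x in B) \sum_(y in B | y != x) links L x y <= 2 * (n.+1 * n).
  rewrite mulnCA -cB -sum_nat_const; apply: leq_sum => x xB.
  have -> : 2 * n = \sum_(y in B | y != x) 2.
    rewrite sum_nat_const (_ : #|_| = #|B :\ x|).
      by have := cardsD1 x B; rewrite xB cB; lia.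
    by apply: eq_card => y; rewrite in_setD1 andbC.
  apply: leq_sum => y /andP[yB yx].
  by apply: pair2; rewrite ?(subsetP BA) // eq_sym.
have disj x y : x \in B -> y \in A :\: B -> y != x.
  by move=> xB; apply: contraTneq => ->; rewrite inE xB.
have cross' : \sum_(x in A :\: B) \sum_(y in B | y != x) links L x y <=
    2 * n * #|A :\: B|.
  rewrite mulnC -sum_nat_const; apply: leq_sum => x xC.
  apply: leq_trans (cross x xC); rewrite [leqRHS](bigID (fun y => y != x)) /=.
  exact: leq_addr.
have cross'' : \sum_(x in B) \sum_(y in A :\: B | y != x) links L x y <=
    2 * n * #|A :\: B|.
  rewrite (exchange_big_dep (mem (A :\: B))) /=; last by move=> x y _ /andP[].
  rewrite mulnC -sum_nat_const; apply: leq_sum => x xC.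
  apply: leq_trans (cross x xC); under eq_bigr do rewrite linksC.
  apply: eq_leq; apply: eq_bigl => y; case yB: (y \in B) => //=.
  by rewrite xC disj.
rewrite (big_setID B) /= (setIidPr BA).
under eq_bigr do rewrite (big_setIDcond _ A B) /= (setIidPr BA).
under [X in _ + X]eq_bigr do rewrite (big_setIDcond _ A B) /= (setIidPr BA).
rewrite !big_split /=; move: IH cross' cross'' inner; rewrite cA; nia.
Qed.
End AlternatingPaths.

(** * Exchanges in a matching of least cost *)

Lemma uniq_map_inj_in (T U : eqType) (f : T -> U) (s : seq T) :
  uniq (map f s) -> {in s &, injective f}.
Proof.
move=> us x y xs ys fxy; have := nth_uniq (f x) _ _ us.
move=> /(_ (index x s) (index y s)); rewrite size_map !index_mem xs ys.
rewrite !(nth_map x) ?index_mem // !nth_index // fxy eqxx => /(_ isT isT)/esym/eqP ixy.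
by rewrite -(nth_index x xs) ixy nth_index.
Qed.

Lemma next_nth_succ (T : eqType) (x0 : T) (s : seq T) (i : nat) :
  uniq s -> i.+1 < size s -> next s (nth x0 s i) = nth x0 s i.+1.
Proof.
move=> us si; rewrite next_nth mem_nth ?(ltnW si) // index_uniq ?(ltnW si) //.
by case: s us si => [|y s] //= _ si; apply: set_nth_default.
Qed.

Section CheapestPairing.
Variables (V X : finType) (lab : V -> V -> nat) (d : nat -> nat).
Hypothesis labC : forall u v, lab u v = lab v u.
Implicit Types (h : {ffun X * bool -> V}) (p q : X * bool).

Definition pair_label h (x : X) : nat := lab (h (x, false)) (h (x, true)).

Definition pairing_cost h : nat := \sum_x d (pair_label h x).

(** For ends of different matching edges this says that the edge joining them
    is critical. *)
Definition undercut h p q : bool :=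
  lab (h p) (h q) < maxn (pair_label h p.1) (pair_label h q.1).

Lemma undercutC h : symmetric (undercut h).
Proof. by move=> p q; rewrite /undercut labC maxnC. Qed.

Lemma pair_labelE h p : lab (h p) (h (opp_end p)) = pair_label h p.1.
Proof. by case: p => x []; rewrite /opp_end /pair_label //= labC. Qed.

Variable h : {ffun X * bool -> V}.
Hypothesis h_inj : injective h.
Hypothesis h_min :
  forall h' : {ffun X * bool -> V}, injective h' -> pairing_cost h <= pairing_cost h'.

Lemma exchange_outside p v : (forall q, h q != v) ->
  d (pair_label h p.1) <= d (lab (h p) v).
Proof.
move=> hv; pose h' := [ffun q => if q == opp_end p then v else h q].
have h'_inj : injective h'.
  move=> q r; rewrite !ffunE; case: eqP => [->|_]; case: eqP => [->|_] //.
  - by move/eqP; rewrite eq_sym (negbTE (hv _)).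
  - by move/eqP; rewrite (negbTE (hv _)).
  - exact: h_inj.
have := h_min h'_inj; rewrite /pairing_cost (bigD1 p.1) //= [leqRHS](bigD1 p.1) //=.
have -> : pair_label h' p.1 = lab (h p) v.
  rewrite /pair_label !ffunE /opp_end; case: (p) => x [] /=.
    by rewrite eqxx xpair_eqE andbF labC.
  by rewrite eqxx xpair_eqE andbF.
rewrite [X in _ <= _ + X](eq_bigr (fun x => d (pair_label h x))) ?leq_add2r //.
move=> x xp; rewrite /pair_label !ffunE /opp_end !xpair_eqE.
by rewrite (negbTE xp).
Qed.

(** Moving the vertex at each entrance to the previous entrance along the cycle
    re-pairs every exit with the next entrance. *)
Lemma exchange_cycle (s : seq (X * bool)) : uniq (map fst s) ->
  \sum_(p <- s) d (pair_label h p.1)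
    <= \sum_(p <- s) d (lab (h (opp_end p)) (h (next s p))).
Proof.
move=> us1; have us := map_uniq us1.
pose h' := [ffun q => h (next s q)].
have h'_inj : injective h'.
  by move=> q r; rewrite !ffunE => /h_inj; apply: can_inj (prev_next us) _ _.
have := h_min h'_inj; rewrite /pairing_cost.
rewrite (bigID (mem (map fst s))) /= [leqRHS](bigID (mem (map fst s))) /=.
have out : \sum_(x | x \notin map fst s) d (pair_label h' x)
         = \sum_(x | x \notin map fst s) d (pair_label h x).
  apply: eq_bigr => x xs; rewrite /pair_label !ffunE !next_nth.
  by do 2!(case: ifP => [/(map_f fst) /= xs'|_]; first by rewrite xs' in xs).
have on (F : X -> nat) : \sum_(x in map fst s) F x = \sum_(p <- s) F p.1.
  by rewrite -(big_map fst xpredT F) big_uniq.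
rewrite out leq_add2r !on => /leq_trans; apply; apply: eq_leq.
apply: eq_big_seq => p ps; congr d.
have -> : pair_label h' p.1 = lab (h' p) (h' (opp_end p)).
  by case: (p) => x []; rewrite /opp_end /pair_label //= labC.
rewrite !ffunE labC; congr (lab (h _) _).
rewrite next_nth; case: ifP => // /= qs.
by have := uniq_map_inj_in us1 ps qs erefl; case: (p) => x [].
Qed.

Variables (l : nat) (m : nat -> nat).
Hypothesis lab_lt : forall u v, lab u v < l.
Hypothesis d_mono : {homo d : i j / i < j}.
Hypothesis d_cross : forall i j k, i < k -> j < k -> k < l -> d i + d j < d 0 + d k.
Hypothesis m_gt0 : forall k, 0 < m k.
Hypothesis d_chain : forall k, 0 < k < l -> m k * d k.-1 + d l.-1 < (m k).+1 * d k.

Let d_le i j : i <= j -> d i <= d j.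
Proof. by rewrite leq_eqVlt => /predU1P[->//|/d_mono/ltnW]. Qed.

Lemma undercut_outside p v : (forall q, h q != v) ->
  (lab (h p) v < pair_label h p.1) = false.
Proof. by move=> /(exchange_outside p) le; apply/negP=> /d_mono; rewrite ltnNge le. Qed.

Lemma undercut_pair x y : x != y -> links (undercut h) x y <= 2.
Proof.
move=> xy.
have no b c : undercut h (x, ~~ b) (y, c) + undercut h (x, b) (y, ~~ c) <= 1.
  have := @exchange_cycle [:: (x, b); (y, c)].
  rewrite !big_cons !big_nil /= !inE xy => /(_ isT); rewrite !eqxx !xpair_eqE.
  rewrite eq_sym (negbTE xy) /= !addn0 /opp_end /= => ex.
  rewrite leqNgt; apply/negP.
  case u1: (undercut _ _ _); case u2: (undercut _ _ _) => // _.
  move: u1 u2 ex; rewrite /undercut /= => u1 u2; apply/negP; rewrite -ltnNge.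
  rewrite (labC (h (y, ~~ c))).
  apply: leq_trans (d_cross u1 u2 _) _; first by rewrite gtn_max !lab_lt.
  rewrite /maxn; case: ifP => _; rewrite ?leq_add2r ?d_le //.
  by rewrite addnC leq_add2l d_le.
rewrite /links !big_bool; move: (no true true) (no true false) => /=.
by move: (undercut _ _ _) (undercut _ _ _) (undercut _ _ _) (undercut _ _ _); lia.
Qed.

(** Closing the path into a cycle joins its two loose ends by an edge whose
    label can only be bounded by the largest one. *)
Lemma undercut_altpath k s : k < l -> altpath (undercut h) s ->
  {subset map fst s <= [set x | pair_label h x == k]} -> size s != (m k).+1.
Proof.
move=> kl /andP[srt us] sk; apply/eqP=> ss.
have lk p : p \in s -> pair_label h p.1 = k.
  by move=> /(map_f fst)/sk; rewrite inE => /eqP.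
have p0 : X * bool by case: (s) ss => [|p].
have link i : i < m k -> lab (h (opp_end (nth p0 s i))) (h (nth p0 s i.+1)) < k.
  move=> im; have := sortedP p0 srt i; rewrite ss ltnS => /(_ im).
  by rewrite /undercut /= !lk ?maxnn ?mem_nth // ss ltnS // ltnW.
have k0 : 0 < k by have := link 0 (m_gt0 k); case: (k).
have := exchange_cycle us; apply/negP; rewrite -ltnNge.
have -> : \sum_(p <- s) d (pair_label h p.1) = (m k).+1 * d k.
  rewrite (eq_big_seq (fun=> d k)) => [|p /lk -> //].
  by rewrite big_const_seq count_predT ss iter_addn_0 mulnC.
apply: leq_ltn_trans (d_chain _); last by rewrite k0.
rewrite (big_nth p0) ss big_nat_recr //=; apply: leq_add; last first.
  by apply: d_le; have := lab_lt (h (opp_end (nth p0 s (m k)))) (h (next s (nth p0 s (m k)))); lia.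
rewrite -[X in X * _](subn0 (m k)) -sum_nat_const_nat.
rewrite !big_nat; apply: leq_sum => i /= im; apply: d_le.
have -> : next s (nth p0 s i) = nth p0 s i.+1.
  by apply: next_nth_succ; rewrite ?(map_uniq us) // ss ltnS.
by have := link i im; lia.
Qed.
End CheapestPairing.

(** * Counting cheaper pairs *)

(** Cauchy-Schwarz, from the square of n i / m i minus the ratio of the sums. *)
Lemma sum_sqr_div_ge (F : realFieldType) (I : finType) (m n : I -> F) :
  (forall i, 0 < m i)%R ->
  ((\sum_i n i) ^+ 2 / (\sum_i m i) <= \sum_i n i ^+ 2 / m i)%R.
Proof.
move=> m0; set N := (\sum_i n i)%R; set E := (\sum_i m i)%R.
have [E0|E0] := eqVneq E 0%R.
  rewrite E0 invr0 mulr0; apply: sumr_ge0 => i _.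
  by rewrite divr_ge0 ?sqr_ge0 // ltW.
have : (0 <= \sum_i m i * (n i / m i - N / E) ^+ 2)%R.
  by apply: sumr_ge0 => i _; rewrite mulr_ge0 ?sqr_ge0 // ltW.
have -> : (\sum_i m i * (n i / m i - N / E) ^+ 2 =
   \sum_i n i ^+ 2 / m i - 2 * (N / E) * N + (N / E) ^+ 2 * E)%R.
  rewrite /N /E mulr_sumr mulr_sumr -sumrB -big_split /=.
  apply: eq_bigr => i _; field.
  by rewrite -/E E0 gt_eqF.
have -> : ((N / E) ^+ 2 * E = N ^+ 2 / E)%R by field.
have -> : (2 * (N / E) * N = 2 * (N ^+ 2 / E))%R by field.
lra.
Qed.

(** Pairs of matching edges with different labels have at most two links, those
    with equal labels are governed by alternating paths; the two estimates add
    up to 2 |X|^2 minus twice a sum of the squares of the class sizes, weighted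
    by 1 / m. *)
Lemma undercut_total (F : realFieldType) (V X : finType) (lab : V -> V -> nat) (d : nat -> nat)
    (l : nat) (m : nat -> nat) (h : {ffun X * bool -> V}) :
  (forall u v, lab u v = lab v u) -> injective h ->
  (forall h' : {ffun X * bool -> V}, injective h' ->
    pairing_cost lab d h <= pairing_cost lab d h') ->
  (forall u v, lab u v < l) ->
  {homo d : i j / i < j} ->
  (forall i j k, i < k -> j < k -> k < l -> d i + d j < d 0 + d k) ->
  (forall k, 0 < m k) ->
  (forall k, 0 < k < l -> m k * d k.-1 + d l.-1 < (m k).+1 * d k) ->
  ((\sum_x \sum_(y | y != x) links (undercut lab h) x y)%:R
    <= 2 * #|X|%:R ^+ 2 * (1 - 1 / (\sum_(k < l) m k)%:R) :> F)%R.
Proof.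
move=> labC h_inj h_min lab_lt d_mono d_cross m_gt0 d_chain.
pose L := undercut lab h; pose lbl := pair_label lab h.
pose A k := [set x | lbl x == k].
have lbl_lt x : lbl x < l by exact: lab_lt.
pose o x : 'I_l := Ordinal (lbl_lt x).
pose S k := \sum_(x in A k) \sum_(y in A k | y != x) links L x y.
have SE k : k < l -> m k * S k <= 2 * (m k).-1 * #|A k| ^ 2.
  move=> kl; apply: alternating_path_bound.
  - exact: undercutC.
  - by move=> x y _ _; apply: undercut_pair lab_lt d_mono d_cross _ _.
  - by move=> s; apply: undercut_altpath lab_lt d_mono m_gt0 d_chain _ _ _.
have byclass (f : X -> nat) : \sum_x f x = \sum_(k < l) \sum_(x in A k) f x.
  rewrite (partition_big o xpredT) //=; apply: eq_bigr => k _.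
  by apply: eq_bigl => x; rewrite inE -val_eqE.
have cX : #|X| = \sum_(k < l) #|A k|.
  by rewrite -sum1_card byclass; apply: eq_bigr => k _; rewrite sum1_card.
have T_le : \sum_x \sum_(y | y != x) links L x y <=
   \sum_(k < l) (S k + 2 * (#|A k| * (#|X| - #|A k|))).
  rewrite byclass; apply: leq_sum => k _.
  rewrite mulnCA -sum_nat_const -big_split /=; apply: leq_sum => x xk.
  rewrite (bigID (mem (A k))) /=; apply: leq_add.
    by apply: eq_leq; apply: eq_bigl => y; rewrite andbC.
  rewrite -(cardsC (A k)) addKn mulnC -sum_nat_const [leqRHS](bigID (fun y => y != x)) /=.
  apply: leq_trans (leq_addr _ _).
  under eq_bigl do rewrite andbC -in_setC.
  apply: leq_sum => y /andP[_ yx].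
  by apply: undercut_pair lab_lt d_mono d_cross _ _ _; rewrite // eq_sym.
have A_le k : #|A k| <= #|X| by exact: max_card.
have Sk (k : 'I_l) : ((S k)%:R <= 2 * #|A k|%:R ^+ 2 - 2 * (#|A k|%:R ^+ 2 / (m k)%:R) :> F)%R.
  have mk : (0 < (m k)%:R :> F)%R by rewrite ltr0n.
  rewrite -(ler_pM2l mk) mulrBr [X in (_ - X)%R](_ : _ = 2 * #|A k|%:R ^+ 2)%R; last first.
    by field; rewrite gt_eqF.
  have := SE k (ltn_ord k); rewrite -(ler_nat F) 3!natrM natrX => /le_trans; apply.
  have -> : ((m k).-1%:R = (m k)%:R - 1 :> F)%R.
    by rewrite -subn1 natrB.
  lra.
have m_pos (k : 'I_l) : (0 < (m k)%:R :> F)%R by rewrite ltr0n.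
have := @sum_sqr_div_ge F 'I_l _ (fun k => #|A k|%:R)%R m_pos.
rewrite -!natr_sum -cX => cauchy.
apply: (@le_trans _ _ (2 * #|X|%:R ^+ 2 - 2 * \sum_(k < l) #|A k|%:R ^+ 2 / (m k)%:R : F)%R); last first.
  by move: cauchy; lra.
rewrite -(ler_nat F) [leRHS]natr_sum in T_le; apply: le_trans T_le _.
have -> : (2 * #|X|%:R ^+ 2 = \sum_(k < l) 2 * (#|A k|%:R * #|X|%:R) :> F)%R.
  by rewrite -mulr_sumr -mulr_suml -natr_sum -cX expr2.
rewrite mulr_sumr -sumrB; apply: ler_sum => k _.
rewrite natrD !natrM natrB //; move: (Sk k); lra.
Qed.

(** * Doubling costs *)

Section Weights.
Variable l : nat.
Hypothesis l_ge2 : 2 <= l.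

(** The values satisfy c(j) = 2 c(j-1) + (l - j) up to a common shift by l - 2,
    for j >= 2.  The doubling factor fixes the main term; the correction l - j
    is positive, which decides ties between two matching edges, and decreasing,
    which decides ties along alternating paths.  The coefficient l * 2 ^ l
    keeps both small next to the main term. *)
Definition label_cost (j : nat) : nat :=
  if j == 0 then l - 2 else l * 2 ^ l * 2 ^ j + j.

(** With costs close to 2^j for j >= 1 and to 0 for j = 0, shifting along an
    alternating path through m + 1 edges of label k pays off to leading order
    when m + 1 > 2^(l-k) - 1 if k >= 2, and when m + 1 > 2^(l-2) if k = 1.  The
    lower-order terms of the cost make it pay off also for m + 1 = 2^(l-k) - 1
    if 2 <= k <= l - 2, which is why m = 2^(l-k) - 2 is allowed there. *)
Definition chain_bound (k : nat) : nat :=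
  if k == 0 then 1 else if k == 1 then 2 ^ (l - 2) else maxn 1 (2 ^ (l - k) - 2).

Lemma label_cost_mono : {homo label_cost : i j / i < j}.
Proof.
move=> i j ij; have j0 : (j == 0) = false by lia.
rewrite /label_cost j0.
have j2 : 0 < 2 ^ j by rewrite expn_gt0.
have l2 : 0 < 2 ^ l by rewrite expn_gt0.
have lz : l <= l * 2 ^ l * 2 ^ j by rewrite -mulnA leq_pmulr // muln_gt0 l2 j2.
case: ifP => _; first by lia.
have : 2 ^ i <= 2 ^ j by rewrite leq_exp2l // ltnW.
by move: (2 ^ i) (2 ^ j) (l * 2 ^ l) => x y z xy; have := leq_mul (leqnn z) xy; lia.
Qed.

Lemma label_cost_cross i j k : i < k -> j < k -> k < l ->
  label_cost i + label_cost j < label_cost 0 + label_cost k.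
Proof.
case: k => // k; rewrite !ltnS => ik jk kl.
have le_mono a : a <= k -> label_cost a <= label_cost k.
  by rewrite leq_eqVlt => /predU1P[->//|/label_cost_mono/ltnW].
apply: leq_ltn_trans (leq_add (le_mono _ ik) (le_mono _ jk)) _.
rewrite /label_cost /= expnS; have l2 : 0 < 2 ^ l by rewrite expn_gt0.
have k2 : 0 < 2 ^ k by rewrite expn_gt0.
by case: ifP => [/eqP->|_]; nia.
Qed.

Lemma chain_bound_gt0 k : 0 < chain_bound k.
Proof. by rewrite /chain_bound; do 2?case: ifP; rewrite ?expn_gt0 ?leq_max. Qed.

Lemma label_cost_chain k : 0 < k < l ->
  chain_bound k * label_cost k.-1 + label_cost l.-1
    < (chain_bound k).+1 * label_cost k.
Proof.
case: k => // k; rewrite /= => kl; rewrite /chain_bound /=.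
have [l' el] : exists n, l = n.+2 by exists (l - 2); lia.
case: k kl => [|k] kl.
  rewrite /label_cost el /= !expnS subn2 /=; have : 0 < 2 ^ l' by rewrite expn_gt0.
  by move: (2 ^ l') => x x0; nia.
rewrite [_.-1]/= [k.+2 == 1]/=; have [r er] : exists r, l' = k + r by exists (l' - k); lia.
have -> : l - k.+2 = r by lia.
have r0 : 0 < r by lia.
have [r1|r2] := leqP r 1.
  have -> : maxn 1 (2 ^ r - 2) = 1 by case: (r) r0 r1 => [|[|]].
  have -> : l.-1 = k.+2 by lia.
  by rewrite mul1n mulSn mul1n ltn_add2r; apply: label_cost_mono.
have Pr : r.+2 <= 2 ^ r.
  case: r {er r0} r2 => [|[|r]] // _; elim: r => // r; rewrite [2 ^ r.+3]expnS.
  by move: (2 ^ _) => z; lia.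
rewrite (maxn_idPr _); last by lia.
rewrite /label_cost /= el /=.
have -> : 2 ^ l'.+1 = 2 ^ k.+1 * 2 ^ r by rewrite -expnD; congr (_ ^ _); lia.
rewrite [2 ^ k.+2]expnS -el; move: (2 ^ k.+1) (l * 2 ^ l) (2 ^ r) Pr => Q a P Pr.
have [p eP] : exists p, P = p.+2 by exists (P - 2); lia.
by rewrite {}eP subn2 er in Pr *; rewrite /=; nia.
Qed.

End Weights.

Lemma sum_chain_bound l : 3 <= l ->
  2 * (\sum_(k < l) chain_bound l k) + 4 * l = 3 * 2 ^ (l - 1) + 8.
Proof.
have tail n : \sum_(i < n.+1) maxn 1 (2 ^ (n.+1 - i) - 2) + 2 * n + 3 = 2 ^ n.+2.
  elim: n => [|n IH]; first by rewrite big_ord1.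
  rewrite big_ord_recl subn0; under eq_bigr do rewrite lift0 subSS.
  move: IH; rewrite [2 ^ n.+3]expnS; have : 4 <= 2 ^ n.+2 by rewrite (@leq_exp2l 2 2).
  by move: (\sum_(i < n.+1) _) => z; lia.
move=> l3; have [n el] : exists n, l = n.+3 by exists (l - 3); lia.
have := tail n; rewrite /chain_bound el !(big_ord_recl n.+2) !(big_ord_recl n.+1) /=.
under [in X in _ -> X]eq_bigr => i _ do rewrite /bump /= !add1n !subSS.
rewrite subn1 subn2 /= !expnS.
by move: (\sum_(i < n.+1) _) => z; lia.
Qed.

(** * From pairings to matchings *)

Section EdgeLabels.
Variables (l N : nat).
Implicit Types (lam : labeling l N) (a b u v w : 'I_N) (e f : edge N).

(** Two equal vertices span no edge, and 0 is then a default value. *)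
Definition elab lam a b : nat := oapp (fun e => lam e : nat) 0 (insub [set a; b]).

Lemma elabC lam a b : elab lam a b = elab lam b a.
Proof. by rewrite /elab finset.setUC. Qed.

Lemma elabE lam e a b : val e = [set a; b] -> elab lam a b = lam e.
Proof. by rewrite /elab => <-; rewrite valK. Qed.

Lemma elab_lt lam a b : 0 < l -> elab lam a b < l.
Proof. by move=> l0; rewrite /elab; case: insub => //= e; apply: ltn_ord. Qed.

Lemma edge_other_end e v : v \in val e -> exists2 w, w != v & val e = [set v; w].
Proof.
have /cards2P[a [b [ab ->]]] := valP e.
rewrite !inE => /orP[]/eqP->; first by exists b; rewrite // eq_sym.
by exists a; rewrite // finset.setUC.
Qed.

Definition mk_edge a b (ab : a != b) : edge N :=
  exist _ [set a; b] (introT eqP (etrans (cards2 a b) (congr1 (fun c : bool => c.+1) ab))).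

Lemma mk_edgeE a b (ab : a != b) : val (mk_edge ab) = [set a; b].
Proof. by []. Qed.

End EdgeLabels.

Section PairingToMatching.
Variables (M N : nat) (h : {ffun 'I_M * bool -> 'I_N}).
Hypothesis h_inj : injective h.

Lemma pair_neq x : h (x, false) != h (x, true).
Proof. by apply/eqP => /h_inj. Qed.

Definition matched_edge (x : 'I_M) : edge N := mk_edge (pair_neq x).

Definition matching_of_pairing : {set edge N} := [set matched_edge x | x : 'I_M].

Lemma mem_matched_edge x v : v \in val (matched_edge x) -> exists b, v = h (x, b).
Proof. by rewrite !inE => /orP[]/eqP->; [exists false | exists true]. Qed.

Lemma matched_edge_end x b : h (x, b) \in val (matched_edge x).
Proof. by rewrite !inE; case: b; rewrite eqxx ?orbT. Qed.

Lemma matched_edge_inj : injective matched_edge.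
Proof.
move=> x y exy; have := matched_edge_end x true.
by rewrite exy => /mem_matched_edge[b /h_inj[]].
Qed.

Lemma card_matching_of_pairing : #|matching_of_pairing| = M.
Proof. by rewrite card_imset ?card_ord //; apply: matched_edge_inj. Qed.

Lemma is_matching_of_pairing : is_matching matching_of_pairing.
Proof.
apply/forall_inP => _ /imsetP[x _ ->]; apply/forall_inP => _ /imsetP[y _ ->].
apply/implyP => xy; apply/existsP => -[v /andP[/mem_matched_edge[b ->]]].
by move=> /mem_matched_edge[c /h_inj[exy _]]; rewrite exy eqxx in xy.
Qed.

Variables (l : nat) (lam : labeling l N) (d : nat -> nat).
Hypothesis h_min : forall h' : {ffun 'I_M * bool -> 'I_N}, injective h' ->
  pairing_cost (elab lam) d h <= pairing_cost (elab lam) d h'.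
Hypothesis d_mono : {homo d : i j / i < j}.

(** Both ends of a critical edge are matched, because the cost cannot be lowered
    by using an unmatched vertex. *)
Lemma critical_undercut e : critical lam matching_of_pairing e ->
  exists p q, [/\ p.1 != q.1, undercut (elab lam) h p q & val e = [set h p; h q]].
Proof.
case/existsP=> _ /andP[/imsetP[x _ ->] /andP[/existsP[v /andP[ve vx]]]].
have [b ev] := mem_matched_edge vx; have [w wv ee] := edge_other_end ve.
rewrite -(elabE lam (mk_edgeE (pair_neq x))) -(elabE lam ee) ev => lt.
have [[q eq_w]|out] := pselect (exists q, w = h q); last first.
  have wh q : h q != w by apply/eqP => qw; apply: out; exists q.
  have := @undercut_outside _ _ _ _ (@elabC l N lam) _ h_inj h_min d_mono (x, b) w wh.
  by rewrite lt.
exists (x, b), q; split; last by rewrite ee ev eq_w.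
  apply/eqP => /= xq; move: lt; rewrite eq_w.
  have -> : q = opp_end (x, b).
    case: q xq eq_w => _ c /= <- eq_w; congr (_, _).
    by apply: contraNeq wv; rewrite eq_w ev; case: (b) (c) => [] [].
  by rewrite pair_labelE ?ltnn //; apply: elabC.
by rewrite /undercut leq_max -eq_w lt.
Qed.

(** Each critical edge is met once in each direction. *)
Lemma critical_count :
  2 * #|[pred e | critical lam matching_of_pairing e]|
    <= \sum_x \sum_(y | y != x) links (undercut (elab lam) h) x y.
Proof.
pose u := undercut (elab lam) h.
pose D := [set z : ('I_M * bool) * ('I_M * bool) | (z.2.1 != z.1.1) && u z.1 z.2].
have -> : \sum_x \sum_(y | y != x) links u x y = #|D|.
  have ends (F : 'I_M * bool -> nat) : \sum_p F p = \sum_x \sum_b F (x, b).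
    by rewrite pair_bigA; apply: eq_bigr => -[].
  rewrite -sum1dep_card [RHS]big_mkcond.
  rewrite -(pair_bigA _ (fun p q => if (q.1 != p.1) && u p q then 1 else 0)) /=.
  rewrite ends; apply: eq_bigr => x _; under [RHS]eq_bigr do rewrite ends.
  rewrite [RHS]exchange_big [LHS]big_mkcond; apply: eq_bigr => y _; rewrite /links.
  by case: (y != x) => /=; [do 2!apply: eq_bigr => ? _; case: (u _ _) | rewrite !big1].
rewrite mulnC -sum_nat_const -sum1_card.
apply: leq_trans (_ : \sum_(e | critical lam matching_of_pairing e)
   \sum_(z in D) (val e == [set h z.1; h z.2]) <= _).
  apply: leq_sum => e /critical_undercut[p [q [pq upq ee]]].
  rewrite -big_mkcondr /= sum1_card.
  apply: (@leq_trans #|[set (p, q); (q, p)]|).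
    by rewrite cards2; case: eqP => // -[epq _]; rewrite epq eqxx in pq.
  apply: subset_leq_card; apply/subsetP => z; rewrite in_set2 unfold_in ee.
  case/orP => /eqP-> /=; rewrite inE /=; first by rewrite eq_sym pq /u upq eqxx.
  by rewrite pq finset.setUC eqxx /u undercutC ?upq //; apply: elabC.
rewrite exchange_big; apply: leq_sum => z _.
rewrite -big_mkcondr /= sum1_card; apply/card_le1_eqP => e f.
by rewrite !unfold_in => /andP[_ /eqP ee] /andP[_ /eqP ef]; apply: val_inj; apply: etrans ef (esym ee).
Qed.
End PairingToMatching.

(** The bound on the number of critical edges holds for every M, without an
    error term. *)
Lemma cheap_matching (F : realFieldType) (l M N : nat) (lam : labeling l N) :
  2 <= l -> 2 * M <= N ->
  exists m : {set edge N}, [/\ is_matching m, #|m| = M &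
    (#|[pred e | critical lam m e]|%:R
      <= M%:R ^+ 2 * (1 - 1 / (\sum_(k < l) chain_bound l k)%:R) :> F)%R].
Proof.
move=> l2 MN.
have lt (p : 'I_M * bool) : 2 * p.1 + p.2 < N.
  by case: p => x b; have := ltn_ord x; case: b => /=; lia.
pose h0 := [ffun p => Ordinal (lt p)].
have h0_inj : injectiveb h0.
  apply/injectiveP => -[x b] [y c]; rewrite !ffunE => -[/= e].
  have ebc : b = c by move: e; case: b; case: c => //=; lia.
  by rewrite ebc; congr (_, _); apply: val_inj; rewrite /=; move: e; rewrite ebc; lia.
pose cost := @pairing_cost _ 'I_M (elab lam) (label_cost l).
case: (@arg_minnP _ h0 (fun h : {ffun _ -> _} => injectiveb h) cost h0_inj) => h /injectiveP h_inj min_h.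
have h_min (h' : {ffun 'I_M * bool -> 'I_N}) : injective h' -> cost h <= cost h' by move/injectiveP; apply: min_h.
exists (matching_of_pairing h_inj); split.
- exact: is_matching_of_pairing.
- exact: card_matching_of_pairing.
have := critical_count h_inj h_min (@label_cost_mono l l2).
have := @undercut_total F _ _ _ _ l (chain_bound l) h (@elabC l N lam) h_inj h_min.
move=> /(_ (fun u v => elab_lt lam u v (ltnW l2)) (@label_cost_mono l l2)).
move=> /(_ (@label_cost_cross l l2) (@chain_bound_gt0 l) (@label_cost_chain l l2)).
by rewrite card_ord -(ler_nat F) natrM; lra.
Qed.

(** * Critical edges forced by a hub and a clique *)

Section PerfectMatchings.
Variables (l N : nat) (m : {set edge N}).
Hypothesis m_perfect : is_perfect_matching m.

(** A perfect matching as a fixed-point free involution. *)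
Lemma perfect_partner : exists mu : 'I_N -> 'I_N,
  [/\ involutive mu, forall v, mu v != v &
      forall v, exists2 f, f \in m & val f = [set v; mu v]].
Proof.
have [/forall_inP mm /forallP cov] := andP m_perfect.
have /choice[mu muP] v : exists w, w != v /\ exists2 f, f \in m & val f = [set v; w].
  have /exists_inP[f fm vf] := cov v.
  by have [w wv ew] := edge_other_end vf; exists w; split=> //; exists f.
exists mu; split=> [v|v|v]; [|by case: (muP v)|by case: (muP v)].
have [muv [f fm ef]] := muP v; have [mumu [g gm eg]] := muP (mu v).
have fg : f = g.
  apply/eqP; apply: contraT => fg.
  have /forall_inP/(_ g gm)/implyP/(_ fg)/negP[] := mm f fm.
  by apply/existsP; exists (mu v); rewrite ef eg !inE eqxx orbT.
have : mu (mu v) \in [set v; mu v] by rewrite -ef fg eg !inE eqxx orbT.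
by rewrite !inE (negbTE mumu) orbF => /eqP.
Qed.

Variables (lam : labeling l N) (mu : 'I_N -> 'I_N).
Hypothesis muP : forall v : 'I_N, exists2 f, f \in m & val f = [set v; mu v].

Definition cover_label v : nat := elab lam v (mu v).

Lemma critical_perfect_pair (e : edge N) (a b : 'I_N) : val e = [set a; b] ->
  elab lam a b < maxn (cover_label a) (cover_label b) -> critical_perfect lam m e.
Proof.
move=> ee; rewrite (elabE lam ee) /critical_perfect => /leq_trans; apply.
have cov v : v \in val e -> cover_label v <= \max_(f in m | Defs.meets e f) lam f.
  move=> ve; have [f fm ef] := muP v.
  rewrite /cover_label (elabE lam ef).
  apply: (@leq_bigmax_cond _ _ (fun f : edge N => lam f : nat) f); rewrite fm /=.
  by apply/existsP; exists v; rewrite ve ef !inE eqxx.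
by rewrite geq_max !cov // ee !inE eqxx ?orbT.
Qed.

Lemma critical_perfect_count :
  \sum_a \sum_b ((a != b) && (elab lam a b < maxn (cover_label a) (cover_label b)))
    <= 2 * #|[pred e | critical_perfect lam m e]|.
Proof.
rewrite pair_bigA /= mulnC -sum_nat_const.
apply: leq_trans (_ : \sum_(z : 'I_N * 'I_N)
   \sum_(e | critical_perfect lam m e) ((z.1 != z.2) && (val e == [set z.1; z.2])) <= _).
  apply: leq_sum => -[a b] _ /=; case: (eqVneq a b) => //= ab.
  case: (boolP (_ < _)) => // lt.
  by rewrite (bigD1 (mk_edge ab)) ?eqxx //=; apply: critical_perfect_pair lt.
rewrite exchange_big; apply: leq_sum => e _.
have [a [b [ab ee]]] : exists a b, a != b /\ val e = [set a; b].
  by have /cards2P[a [b [ab ->]]] := valP e; exists a, b.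
rewrite -big_mkcond sum1_card.
apply: (@leq_trans #|[set (a, b); (b, a)]|); last by rewrite cards2; case: (_ != _).
apply: subset_leq_card; apply/subsetP => -[x y]; rewrite unfold_in /= ee => /andP[xy /eqP exy].
move: xy; have : x \in [set a; b] by rewrite exy !inE eqxx.
have : y \in [set a; b] by rewrite exy !inE eqxx orbT.
rewrite !inE !xpair_eqE => /orP[]/eqP-> /orP[]/eqP->; rewrite ?eqxx ?orbT //.
Qed.

Hypothesis muK : involutive mu.
Hypothesis mu_neq : forall v, mu v != v.
Variables (S T : {set 'I_N}).
Hypothesis ST : [disjoint S & T].
Hypothesis labS : forall a b, a != b -> a \in S -> elab lam a b = 0.
Hypothesis labT : forall a b, a != b -> a \in T -> b \in T -> elab lam a b = 0.
Hypothesis labTU : forall a b, a \in T -> b \notin S -> b \notin T -> 0 < elab lam a b.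
Hypothesis labUU : forall a b, a != b -> a \notin S -> a \notin T ->
  b \notin S -> b \notin T -> 0 < elab lam a b.
Hypothesis labTUU : forall t u a b, t \in T -> u \notin S -> u \notin T ->
  a != b -> a \notin S -> a \notin T -> b \notin S -> b \notin T ->
  elab lam t u < elab lam a b.

(** Here t1 counts the vertices of T matched outside S and T, and u2 the
    vertices outside S and T matched among themselves.  The critical ordered
    pairs found are those between S and a vertex whose cover label is positive,
    those inside T with an end among the t1, and those between T and the u2. *)
Lemma hub_clique_count : exists t1 u2, [/\ t1 <= #|T|, N <= 2 * #|S| + #|T| + t1 + u2 &
  2 * #|S| * (2 * t1 + u2) + t1 ^ 2 + 2 * t1 * (#|T| - t1) + 2 * #|T| * u2
    <= 2 * #|[pred e | critical_perfect lam m e]| + t1].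
Proof.
pose T1 v := [&& v \in T, mu v \notin S & mu v \notin T].
pose U0 v := [&& v \notin S, v \notin T & mu v \in S].
pose U1 v := [&& v \notin S, v \notin T & mu v \in T].
pose U2 v := [&& v \notin S, v \notin T, mu v \notin S & mu v \notin T].
pose pos v := [|| T1 v, U1 v | U2 v].
pose K a b := (a != b) && (elab lam a b < maxn (cover_label a) (cover_label b)).
have dST v : v \in T -> v \notin S.
  by move=> vT; apply/negP=> vS; move/pred0P: ST => /(_ v) /=; rewrite vS vT.
have KC a b : K a b = K b a by rewrite /K eq_sym elabC maxnC.
have pos_out v : pos v -> v \notin S by case/or3P=> /and3P[] // /dST.
have pos_gt0 v : pos v -> 0 < cover_label v.
  rewrite /pos /cover_label => /or3P[] /and3P[h1 h2 h3].
  - exact: labTU.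
  - by rewrite elabC; apply: labTU.
  - by case/andP: h3 => h3 h4; apply: labUU; rewrite // eq_sym.
have K0 a b : a != b -> elab lam a b = 0 -> pos a || pos b -> K a b.
  move=> ab e0 pab; rewrite /K ab e0 leq_max.
  by case/orP: pab => /pos_gt0->; rewrite ?orbT.
have KS a b : a \in S -> pos b -> K a b.
  move=> aS pb; have ab : a != b by apply: contraTneq aS => ->; apply: pos_out.
  by apply: K0; rewrite ?labS ?pb ?orbT.
have KT a b : a != b -> a \in T -> b \in T -> pos a || pos b -> K a b.
  by move=> ab aT bT; apply: K0; rewrite // labT.
have KU a b : a \in T -> U2 b -> K a b.
  move=> aT /and4P[b1 b2 b3 b4]; rewrite /K; have -> /= : a != b by apply: contraNneq b2 => <-.
  by rewrite leq_max orbC labTUU // eq_sym.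
(* T1 x T1 contains diagonal pairs, which are no edges; the last term makes up
   for them. *)
have point a b : (a \in S) * pos b + pos a * (b \in S) + T1 a * T1 b
    + T1 a * ((b \in T) && ~~ T1 b) + ((a \in T) && ~~ T1 a) * T1 b
    + (a \in T) * U2 b + U2 a * (b \in T) <= K a b + ((a == b) && T1 a).
  have kS := @KS a b; have kS' := @KS b a; have kT := @KT a b.
  have kU := @KU a b; have kU' := @KU b a; have da := dST a; have db := dST b.
  rewrite (KC b a) in kS' kU'.
  rewrite /pos /T1 /U1 /U2 in kS kS' kT kU kU' *.
  case: eqVneq kT => [eab|_] /= kT.
    move: (K a b) kS kS' kT kU kU' => kab; rewrite -{}eab {db}; move: da.
    move: (a \in S) (a \in T) (mu a \in S) (mu a \in T); by do 4!case; lia.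
  move: (K a b) kS kS' kT kU kU' da db => kab.
  move: (a \in S) (a \in T) (mu a \in S) (mu a \in T).
  move: (b \in S) (b \in T) (mu b \in S) (mu b \in T).
  by case: kab => /=; do 8!case => //=; lia.
pose c (P : pred 'I_N) := \sum_v P v.
have cE (P : pred 'I_N) : c P = #|P| by rewrite -sum1_card [RHS]big_mkcond.
have dbl (P Q : pred 'I_N) : \sum_a \sum_b P a * Q b = c P * c Q.
  by rewrite /c big_distrlr.
have c_mu (P : pred 'I_N) : c (fun v => P (mu v)) = c P.
  by rewrite /c [RHS](reindex_inj (inv_inj muK)).
have c_add (P Q R : pred 'I_N) : (forall v, P v = Q v + R v :> nat) -> c P = c Q + c R.
  by move=> h; rewrite /c -big_split; apply: eq_bigr => v _; apply: h.
pose inS v := v \in S; pose inT v := v \in T; pose T0 v := (v \in T) && ~~ T1 v.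
have cS : c inS = #|S| by exact: cE.
have cT : c inT = #|T| by exact: cE.
have cT01 : c inT = c T1 + c T0.
  apply: c_add => v; rewrite /inT /T0 /T1; move: (v \in T) (mu v \notin S) (mu v \notin T); lia.
have cpos : c pos = c T1 + (c U1 + c U2).
  rewrite -(@c_add (fun v => U1 v || U2 v)).
    apply: c_add => v; rewrite /pos /T1 /U1 /U2.
    move: (v \in S) (v \in T) (mu v \in S) (mu v \in T); lia.
  move=> v; rewrite /U1 /U2; move: (mu v \in T); lia.
have cU1 : c U1 = c T1.
  rewrite -[RHS]c_mu; apply: eq_bigr => v _; rewrite /U1 /T1 muK.
  by case: (mu v \in T); rewrite ?andbF ?andbT.
have cU0 : c U0 <= c inS.
  rewrite -(c_mu inS); apply: leq_sum => v _; rewrite /U0 /inS.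
  by case: (mu v \in S); rewrite ?andbF // leq_b1.
have cN : N = c inS + c inT + c U0 + c U1 + c U2.
  rewrite -[LHS]card_ord -sum1_card -!big_split; apply: eq_bigr => v _ /=.
  rewrite /inS /inT /U0 /U1 /U2; move: (dST v) (dST (mu v)).
  move: (v \in S) (v \in T) (mu v \in S) (mu v \in T); lia.
exists (c T1), (c U2); split; first by rewrite -cT cT01 leq_addr.
  by rewrite -cS -cT {1}cN cU1; lia.
have := leq_trans _ critical_perfect_count.
move=> /(_ (\sum_a \sum_b K a b) (leqnn _)) le_crit.
have diag : \sum_a \sum_b ((a == b) && T1 a) = c T1.
  apply: eq_bigr => a _; rewrite (bigD1 a) //= eqxx big1 ?addn0 // => b.
  by rewrite eq_sym => /negbTE->.
have le_point : \sum_a \sum_b ((a \in S) * pos b + pos a * (b \in S) + T1 a * T1 b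
    + T1 a * ((b \in T) && ~~ T1 b) + ((a \in T) && ~~ T1 a) * T1 b
    + (a \in T) * U2 b + U2 a * (b \in T)) <= \sum_a \sum_b K a b + c T1.
  by rewrite -diag -big_split; apply: leq_sum => a _; rewrite -big_split; apply: leq_sum.
move: le_point le_crit; under eq_bigr do rewrite !big_split.
rewrite !big_split /= !(dbl inS, dbl _ inS, dbl _ inT, dbl inT, dbl T1, dbl T0).
rewrite -cS -cT cpos cU1 cT01 addKn -mulnn.
by move: (c inS) (c T1) (c T0) (c U2) (\sum_a _) => x y z t w; nia.
Qed.
End PerfectMatchings.

(** * Extremal labelings *)

Section LayeredLabeling.
Variables (n N : nat) (S T : {set 'I_N}).

(** S is the hub and T the clique of the least label. *)
Definition layered_labeling : labeling n.+1 N :=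
  [ffun e : edge N => inord
    (if (val e :&: S != set0) || (val e \subset T) then 0
     else if val e :&: T != set0 then 1 else n)].

Lemma layered_labelE a b : 0 < n -> a != b ->
  elab layered_labeling a b =
    if [|| a \in S, b \in S | (a \in T) && (b \in T)] then 0
    else if (a \in T) || (b \in T) then 1 else n.
Proof.
move=> n0 ab; rewrite (elabE _ (mk_edgeE ab)) ffunE mk_edgeE.
have meet (A : {set 'I_N}) : ([set a; b] :&: A != set0) = (a \in A) || (b \in A).
  apply/set0Pn/idP => [[x]|/orP[xA|xA]].
  - by rewrite !inE => /andP[/orP[]/eqP-> ->]; rewrite ?orbT.
  - by exists a; rewrite !inE eqxx.
  - by exists b; rewrite !inE eqxx orbT.
by rewrite !meet subUset !sub1set orbA inordK //; do !case: ifP.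
Qed.
End LayeredLabeling.

Lemma card_ord_lt N k : k <= N -> #|[set i : 'I_N | i < k]| = k.
Proof.
by move=> kN; rewrite cardsE -sum1_card -(big_ord_widen N (fun=> 1) kN) sum1_card card_ord.
Qed.

Definition hub_labeling k : labeling 2 (2 * (2 * k)) :=
  layered_labeling 1 [set i : 'I_(2 * (2 * k)) | i < k] set0.

Definition hub_clique_labeling k : labeling 3 (2 * (4 * k)) :=
  layered_labeling 2 [set i : 'I_(2 * (4 * k)) | i < k]
    [set i : 'I_(2 * (4 * k)) | k <= i < 3 * k].

Lemma hub_labeling_critical k (m : {set edge (2 * (2 * k))}) :
  is_perfect_matching m ->
  2 * k ^ 2 <= #|[pred e | critical_perfect (hub_labeling k) m e]|.
Proof.
move=> pm; rewrite /hub_labeling; set S := [set i : 'I_ _ | i < k].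
have cS : #|S| = k by rewrite card_ord_lt //; lia.
have [mu [muK mu_neq muP]] := perfect_partner pm.
have [||||||t1 [u2 []]] := @hub_clique_count 1.+1 _ m pm
    (layered_labeling 1 S set0) mu muP muK mu_neq S set0.
- by rewrite -setI_eq0 finset.setI0.
- by move=> a b ab aS; rewrite layered_labelE // aS.
- by move=> a b ab; rewrite inE.
- by move=> a b; rewrite inE.
- move=> a b ab /negbTE aS _ /negbTE bS _.
  by rewrite layered_labelE // aS bS !in_set0.
- by move=> t u a b; rewrite inE.
rewrite cards0 cS leqn0 => /eqP->.
by move: #|_| => w; nia.
Qed.

Lemma hub_clique_labeling_critical k (m : {set edge (2 * (4 * k))}) :
  is_perfect_matching m ->
  12 * k ^ 2 <= #|[pred e | critical_perfect (hub_clique_labeling k) m e]| + k.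
Proof.
move=> pm; rewrite /hub_clique_labeling.
set S := [set i : 'I_ _ | i < k]; set T := [set i : 'I_ _ | _ <= _ < _].
have cS : #|S| = k by rewrite card_ord_lt //; lia.
have cT : #|T| = 2 * k.
  have /card_ord_lt : 3 * k <= 2 * (4 * k) by lia.
  rewrite -(cardsID S) (_ : _ :&: _ = S) ?cS; last by apply/setP=> i; rewrite !inE; lia.
  by rewrite (_ : _ :\: _ = T); [lia | apply/setP=> i; rewrite !inE; lia].
have TS i : i \in T -> (i \in S) = false by rewrite !inE; lia.
have [mu [muK mu_neq muP]] := perfect_partner pm.
have [||||||t1 [u2 []]] := @hub_clique_count 2.+1 _ m pm
    (layered_labeling 2 S T) mu muP muK mu_neq S T.
- by rewrite disjoints_subset; apply/subsetP=> i; rewrite !inE; lia.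
- by move=> a b ab aS; rewrite layered_labelE // aS.
- by move=> a b ab aT bT; rewrite layered_labelE // aT bT !orbT.
- move=> a b aT bS bT; have ab : a != b by apply: contraNneq bT => <-.
  by rewrite layered_labelE // TS // aT (negbTE bS) (negbTE bT).
- move=> a b ab /negbTE aS /negbTE aT /negbTE bS /negbTE bT.
  by rewrite layered_labelE // aS aT bS bT.
- move=> t u a b tT uS uT ab /negbTE aS /negbTE aT /negbTE bS /negbTE bT.
  have tu : t != u by apply: contraNneq uT => <-.
  by rewrite !layered_labelE // aS aT bS bT TS // tT (negbTE uS) (negbTE uT).
rewrite cT cS; move: #|_| => w; nia.
Qed.

(** * Limits superior *)

Local Open Scope ring_scope.

Section LimitSuperior.
Local Open Scope classical_set_scope.
Variable R : realType.
Implicit Types (u v : (\bar R)^nat) (c : \bar R).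

Lemma le_limn_esup u v : (forall n, (u n <= v n)%E) -> (limn_esup u <= limn_esup v)%E.
Proof.
move=> uv; apply: le_ereal_inf_tmp => _ [V Voo <-]; apply: ge_ereal_inf.
exists (ereal_sup (u @` V)); first by exists V.
apply: ge_ereal_sup => _ [n Vn <-]; apply: le_ereal_sup_tmp.
by exists (v n); [exists n | apply: uv].
Qed.

Lemma limn_esup_le u c n0 : (forall n, (n0 <= n)%N -> (u n <= c)%E) ->
  (limn_esup u <= c)%E.
Proof.
move=> uc; apply: ge_ereal_inf; exists (ereal_sup (u @` [set n | (n0 <= n)%N])).
  by exists [set n | (n0 <= n)%N] => //; exists n0.
by apply: ge_ereal_sup => _ [n /= n0n <-]; apply: uc.
Qed.

(** Lower bounds along a subsequence suffice. *)
Lemma limn_esup_ge u c : (forall n0, exists2 n, (n0 <= n)%N & (c <= u n)%E) ->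
  (c <= limn_esup u)%E.
Proof.
move=> cu; apply: le_ereal_inf_tmp => _ [V [n0 _ n0V] <-].
have [n n0n cn] := cu n0; apply: le_ereal_sup_tmp; exists (u n) => //.
by exists n => //; apply: n0V.
Qed.
End LimitSuperior.

(** * Bounds on gamma and gamma' *)

Lemma natr_bin2 (F : numFieldType) (n : nat) : (0 < n)%N ->
  'C(n, 2)%:R = n%:R * (n%:R - 1) / 2 :> F.
Proof.
case: n => // n _; have two : (2 : F) != 0 by rewrite pnatr_eq0.
have -> : n.+1%:R - 1 = n%:R :> F by rewrite -natr1 addrK.
apply: (mulIf two); rewrite mulfVK // -!natrM.
by rewrite -[2%N]/(2`!)%N bin_ffact ffactnS ffactn1.
Qed.

Lemma critical_perfectE l N (lam : labeling l N) (m : {set edge N}) e :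
  critical_perfect lam m e = critical lam m e.
Proof.
rewrite /critical_perfect /critical; apply/idP/existsP => [lt|[f /and3P[fm ef lt]]].
  apply: contrapT => no; move: lt; rewrite ltnNge => /negP; apply.
  apply/bigmax_leqP => f /andP[fm ef]; rewrite leqNgt; apply/negP => lt.
  by apply: no; exists f; rewrite fm ef.
by apply: leq_trans lt (@leq_bigmax_cond _ _ (fun f : edge N => lam f : nat) f _); rewrite fm.
Qed.

(** M disjoint edges cover 2M vertices, hence all of them. *)
Lemma perfect_of_card M (m : {set edge (2 * M)}) :
  is_matching m -> #|m| = M -> is_perfect_matching m.
Proof.
move=> mm cm; rewrite /is_perfect_matching mm /=.
pose P := [set val e | e in m]%SET.
have tP : trivIset P.
  apply/trivIsetP => _ _ /imsetP[e em ->] /imsetP[f fm ->] ef.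
  have {}ef : e != f by apply: contraNneq ef => ->.
  have /forall_inP/(_ f fm)/implyP/(_ ef) := forall_inP mm e em.
  by apply: contraR => /pred0Pn[v vef]; apply/existsP; exists v.
have cardP : #|P| = M by rewrite -[RHS]cm; apply: card_imset; apply: val_inj.
have cP : #|cover P| = (2 * M)%N.
  move: tP; rewrite /trivIset => /eqP <-.
  rewrite (eq_bigr (fun=> 2%N)) => [|_ /imsetP[e _ ->]]; last exact/eqP/(valP e).
  by rewrite sum_nat_const cardP mulnC.
have coverT : cover P = [set: 'I_(2 * M)]%SET.
  by apply/eqP; rewrite eqEcard finset.subsetT cP cardsT card_ord /= leqnn.
apply/forallP => v; have : v \in cover P by rewrite coverT finset.in_setT.
by case/bigcupP => _ /imsetP[e em ->] ve; apply/exists_inP; exists e.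
Qed.

Section Values.
Variable R : realType.

Lemma gamma'_le_gamma l : (gamma' R l <= gamma R l)%E.
Proof.
apply: le_limn_esup => M; apply: le_ereal_sup_tmp.
exists (gamma_maxmin R l M (2 * M)); first by exists (2 * M)%N => /=.
apply: le_bigmax2 => lam _; apply/bigmin_geP; split=> [|m /andP[mm /eqP cm]].
  exact: bigmin_le_id.
apply: (bigmin_inf m _ _ _ (perfect_of_card mm cm)).
rewrite /critical_perfect_ratio /critical_ratio.
by rewrite (eq_card (critical_perfectE lam m)).
Qed.

(** Since x / binomial(2M, 2) is at most (1 - 1 / E) M / (2M - 1), any M with
    eps * M >= 1 is large enough for an error eps. *)
Lemma gamma_le l : (2 <= l)%N ->
  (gamma R l <= ((1 - 1 / (\sum_(k < l) chain_bound l k)%:R) / 2)%:E)%E.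
Proof.
move=> l2; set E : R := (_)%:R; apply/lee_addgt0Pr => eps eps0.
have E0 : 0 <= 1 / E by rewrite divr_ge0 ?ler0n.
pose n0 := (Num.truncn (eps^-1)).+1.
apply: (@limn_esup_le _ _ _ n0) => M n0M; apply: ge_ereal_sup => _ [N /= MN <-].
apply/bigmax_leP; split=> [|lam _]; first by rewrite leNye.
have [m [mm cm crit]] := @cheap_matching R l M N lam l2 MN.
apply: (bigmin_inf m); first by rewrite mm cm eqxx.
rewrite -EFinD lee_fin.
have M0 : (0 < M)%N by apply: leq_trans n0M.
have M1 : 1 <= M%:R :> R by rewrite ler1n.
have epsM : 1 <= eps * M%:R.
  rewrite -ler_pdivrMl // mulr1; apply: (@le_trans _ _ n0%:R); last by rewrite ler_nat.
  by apply/ltW/truncnS_gt.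
rewrite ler_pdivrMr ?ltr0n ?bin_gt0; last by lia.
apply: (le_trans crit); rewrite natr_bin2 ?muln_gt0 // natrM -/E.
have -> : 2%:R * M%:R * (2%:R * M%:R - 1) / 2 = M%:R * (2 * M%:R - 1) :> R by field.
rewrite mulrDl.
have : 2 * M%:R - 1 <= eps * (M%:R * (2 * M%:R - 1)) by rewrite mulrA ler_peMl //; lra.
have : 0 <= M%:R * (1 / E) by rewrite mulr_ge0.
set c := 1 / E in E0 *; move: M%:R M1 => x x1; nra.
Qed.

Lemma gamma'_ge l c (k0 : nat) (lam : forall k, labeling l (2 * (k0 * k))) :
  (0 < k0)%N ->
  (forall k (m : {set edge (2 * (k0 * k))}), (0 < k)%N -> is_perfect_matching m ->
     c * 'C(2 * (k0 * k), 2)%:R <= #|[pred e | critical_perfect (lam k) m e]|%:R) ->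
  (c%:E <= gamma' R l)%E.
Proof.
move=> k00 crit; apply: limn_esup_ge => n0; exists (k0 * n0.+1)%N.
  by rewrite (leq_trans (leqnSn n0)) // leq_pmull.
apply: le_trans (le_bigmax _ _ (lam n0.+1)).
apply/bigmin_geP; split=> [|m mp]; first by rewrite leey.
rewrite lee_fin ler_pdivlMr; first exact: crit.
by rewrite ltr0n bin_gt0; nia.
Qed.

Lemma gamma'2_ge : ((1 / 4)%:E <= gamma' R 2)%E.
Proof.
apply: (@gamma'_ge 2 _ 2 hub_labeling) => //.
move=> k m k0 /hub_labeling_critical; rewrite -(ler_nat R); apply: le_trans.
rewrite natr_bin2; last by lia.
rewrite !natrM; have : 1 <= k%:R :> R by rewrite ler1n.
by move: k%:R => x x1; nra.
Qed.

Lemma gamma'3_ge : ((3 / 8)%:E <= gamma' R 3)%E.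
Proof.
apply: (@gamma'_ge 3 _ 4 hub_clique_labeling) => //.
move=> k m k0 /hub_clique_labeling_critical; rewrite -(ler_nat R) natrD -lerBlDr; apply: le_trans.
rewrite natr_bin2; last by lia.
rewrite !natrM; have : 1 <= k%:R :> R by rewrite ler1n.
by move: k%:R => x x1; nra.
Qed.
End Values.

(** * Closed forms *)

Section ClosedForms.
Variable R : realType.

Lemma gamma_le_formula l : (3 <= l)%N ->
  (gamma R l <= (1 / 2 - 1 / (3 * 2 ^+ (l - 1) - 4 * l%:R + 8))%:E)%E.
Proof.
move=> l3; apply: (le_trans (gamma_le R (ltnW l3))); rewrite lee_fin.
set E : R := (_)%:R.
have EE : 3 * 2 ^+ (l - 1) - 4 * l%:R + 8 = 2 * E.
  have := congr1 (fun k => k%:R : R) (sum_chain_bound l3).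
  rewrite [LHS]natrD [RHS]natrD !natrM natrX -/E => eE; lra.
have l0 : (0 < l)%N by lia.
have E0 : E != 0.
  rewrite pnatr_eq0 -lt0n (leq_trans (chain_bound_gt0 l 0)) //.
  by rewrite (bigD1 (Ordinal l0)) //= leq_addr.
by rewrite EE le_eqVlt; apply/orP; left; apply/eqP; field.
Qed.

Lemma gamma_2_le : (gamma R 2 <= (1 / 4)%:E)%E.
Proof.
apply: (le_trans (gamma_le R (leqnn 2))).
have -> : (\sum_(k < 2) chain_bound 2 k)%N = 2%N by rewrite !big_ord_recl big_ord0.
by rewrite lee_fin; lra.
Qed.

Lemma gamma_3_le : (gamma R 3 <= (3 / 8)%:E)%E.
Proof.
apply: (le_trans (gamma_le_formula (leqnn 3))).
have -> : 3 * 2 ^+ (3 - 1) - 4 * 3%:R + 8 = 8 :> R by rewrite -[(3 - 1)%N]/2%N; ring.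
by rewrite lee_fin; lra.
Qed.
End ClosedForms.

Theorem theorem8 (R : realType) :
  [/\ gamma' R 2 = (1 / 4 : R)%:E /\ gamma R 2 = (1 / 4 : R)%:E,
      gamma' R 3 = (3 / 8 : R)%:E /\ gamma R 3 = (3 / 8 : R)%:E &
      forall l : nat, (4 <= l)%N ->
        (gamma' R l <= gamma R l)%E /\
        (gamma R l <=
          (1 / 2 - 1 / (3 * 2 ^+ (l - 1) - 4 * l%:R + 8) : R)%:E)%E].
Proof.
have squeeze l (c : \bar R) : (c <= gamma' R l)%E -> (gamma R l <= c)%E ->
    gamma' R l = c /\ gamma R l = c.
  move=> lo up; have gg := gamma'_le_gamma R l.
  by split; apply/eqP; rewrite eq_le ?lo ?up ?(le_trans gg up) ?(le_trans lo gg).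
split.
- exact: squeeze (gamma'2_ge R) (gamma_2_le R).
- exact: squeeze (gamma'3_ge R) (gamma_3_le R).
move=> l l4; split; first exact: gamma'_le_gamma.
exact/gamma_le_formula/ltnW.
Qed.
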